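(* Let $\mathcal{H}$ be a real Hilbert space and let $J:\mathcal{H}\to\mathbb{R}\cup\{\infty\}$ be convex, lower semi-continuous and absolutely one-homogeneous, with null-space $\mathcal{N}(J)=\{u\in\mathcal{H} : J(u)=0\}$. Assume: (i) there is a constant $c_P>0$ such that $c_P\|u\|\le J(u)$ for all $u\in\mathcal{N}(J)^\perp$; (ii) the sub-level sets of $u\mapsto \|u\|+J(u)$ are compact. Let $f\in\mathcal{N}(J)^\perp$, $f\neq0$, let $u^0=f/\|f\|$ satisfy $0<J(u^0)<\infty$, and let $c\in(0,1)$ be a constant. Let the regularization parameters $\alpha(u)\ge 0$ follow either the constant parameter rule $\alpha(u)=\dfrac{c}{J(u^0)}$ or the variable parameter rule $\alpha(u)\le\dfrac{c}{J(u)}$. Let $(u^k)\subset\mathcal{H}$ be the sequence generated by the proximal power method $$u^0=\frac{f}{\|f\|},\qquad v^k=\operatorname{prox}^J_{\alpha(u^k)}(u^k),\qquad u^{k+1}=\frac{v^k}{\|v^k\|},\qquad k\ge 0.$$ Then a subsequence of $(u^k)$ converges to some $u^*\in\mathcal{H}\setminus\{0\}$ which satisfies $\lambda u^*=\operatorname{prox}^J_{\alpha(u^* )}(u^* )$ for some $0<\lambda<1$.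
   Context: Absolutely one-homogeneous means $J(cu)=|c|J(u)$ for all $u\in\mathcal{H}$ and all $c\neq0$, and $J(0)=0$. The set $\mathcal{N}(J)$ is a linear space and $\mathcal{N}(J)^\perp$ is its orthogonal complement. For a regularization parameter $\alpha\ge0$ the proximal operator is $\operatorname{prox}^J_\alpha(u)=\arg\min_{v\in\mathcal{H}}\frac12\|v-u\|^2+\alpha J(v)$. Regularization parameters $\alpha(u)$ are allowed to depend on $u$. Convergence is in the norm of $\mathcal{H}$.
   Formalization: For the variable parameter rule it is additionally assumed that α(w)>0 whenever 0<J(w)<∞ and that the sum of α(u^k) over k diverges; without this α=0 is allowed, prox is the identity, and λ=1 is forced. *)

(* Defs.v *)
From mathcomp Require Export all_boot all_order all_algebra.
From mathcomp Require Export all_classical all_reals all_analysis.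
Export Order.TTheory GRing.Theory Num.Theory.
Export numFieldNormedType.Exports.

Set Implicit Arguments.
Unset Strict Implicit.
Unset Printing Implicit Defensive.

Local Open Scope classical_set_scope.
Local Open Scope ring_scope.

(* A real Hilbert space is a complete normed space [H] together with a dot
   product inducing its norm. *)
Definition induces_norm (R : realType) (H : completeNormedModType R)
    (ip : {dot H for (@idfun R)}) : Prop :=
  forall x : H, `|x| ^+ 2 = ip x x.

Definition proper_codomain (R : realType) (H : Type) (J : H -> \bar R) : Prop :=
  forall u, J u != -oo%E.

(* [0 * +oo = 0] in [\bar R], so the endpoints t = 0, 1 impose nothing. *)
Definition econvex (R : realType) (H : lmodType R) (J : H -> \bar R) : Prop :=
  forall (x y : H) (t : R), 0 <= t <= 1 ->
    (J (t *: x + (1 - t) *: y)%R <= t%:E * J x + (1 - t)%:E * J y)%E.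

Definition abs_one_homogeneous (R : realType) (H : lmodType R)
    (J : H -> \bar R) : Prop :=
  (forall (c : R) (u : H), c != 0 -> J (c *: u) = (`|c|%:E * J u)%E)
  /\ J 0 = 0%E.

Definition nullspace (R : realType) (H : lmodType R) (J : H -> \bar R) : set H :=
  [set u | J u = 0%E].

Definition orthocompl (R : realType) (H : completeNormedModType R)
    (ip : {dot H for (@idfun R)}) (A : set H) : set H :=
  [set u | forall w, A w -> ip u w = 0].

Definition prox_objective (R : realType) (H : completeNormedModType R)
    (J : H -> \bar R) (a : R) (u v : H) : \bar R :=
  ((2^-1 * `|v - u| ^+ 2)%:E + a%:E * J v)%E.

Definition argmin (R : realType) (T : Type) (F : T -> \bar R) : set T :=
  [set v | forall w, (F v <= F w)%E].

(* The minimizer exists and is unique for J convex, lower semi-continuous,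
   proper and a > 0; otherwise [xget] returns some minimizer, or 0 if there is
   none. *)
Definition prox (R : realType) (H : completeNormedModType R)
    (J : H -> \bar R) (a : R) (u : H) : H :=
  xget 0 (argmin (prox_objective J a u)).

Definition proximal_power_method (R : realType) (H : completeNormedModType R)
    (J : H -> \bar R) (alpha : H -> R) (f : H) (u v : nat -> H) : Prop :=
  [/\ u 0%N = `|f|^-1 *: f,
      forall k, v k = prox J (alpha (u k)) (u k)
    & forall k, u k.+1 = `|v k|^-1 *: v k].

Definition constant_rule (R : realType) (H : Type) (J : H -> \bar R)
    (c : R) (u0 : H) (alpha : H -> R) : Prop :=
  forall w, (alpha w)%:E = (c%:E / J u0)%E.

Definition variable_rule (R : realType) (H : Type) (J : H -> \bar R)
    (c : R) (alpha : H -> R) : Prop :=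
  forall w, (0 < J w < +oo)%E -> ((alpha w)%:E <= c%:E / J w)%E.

(* The upper bound of the variable rule alone allows alpha = 0, for which
   prox is the identity and every point is fixed (lambda = 1), and it allows
   summable steps, for which the iteration stalls at arbitrary points.  The
   constant rule, and alpha w = c / J w, satisfy both conditions below. *)
Definition nonvanishing (R : realType) (H : Type) (J : H -> \bar R)
    (alpha : H -> R) (u : nat -> H) : Prop :=
  (forall w, (0 < J w < +oo)%E -> 0 < alpha w)
  /\ (\sum_(0 <= k <oo) (alpha (u k))%:E = +oo)%E.

(* Main.v *)
Require Import Defs.
From mathcomp Require Import ring lra.

Set Implicit Arguments.
Unset Strict Implicit.
Unset Printing Implicit Defensive.

Local Open Scope classical_set_scope.
Local Open Scope ring_scope.

(** Write J_k = J(u^k) and p^k = (u^k - v^k) / alpha(u^k).  Optimality of v^k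
    says that p^k is a subgradient of J at v^k, hence, by one-homogeneity, also
    at u^{k+1} = v^k / |v^k|.  Testing p^k against u^k and u^{k+1}, and using
    |u^k| = 1, pins the norm of v^k:
      1 - alpha J_k <= |v^k| <= 1 - alpha J_{k+1},
    so J_k decreases, and the same two tests give the quantitative form
    ([power_step])
      alpha(u^k) |p^k - J_{k+1} u^{k+1}|^2 <= 2 (J_k - J_{k+1}).
    The right-hand side telescopes while the steps alpha(u^k) have infinite
    sum, so the residual p^k - J_{k+1} u^{k+1} tends to zero along some
    subsequence ([liminf_weight]).

    All u^k are unit vectors with J_k <= J_0, hence lie in a compact sub-level
    set, and a further subsequence of u^{k+1} converges to some unit vector x
    ([compact_subsequence]).  Along it p^k converges to mu x with
    mu = lim J_k, and since the graph of the subdifferential is closed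
    ([subgradient_closed]), mu x is a subgradient of J at x, with
    J(x) = mu.  The subgradients p^k are orthogonal to the null-space of J,
    so the iterates never leave its orthogonal complement, where the Poincare
    inequality gives J_k >= c_P; therefore mu > 0.

    Finally, an eigenvector is only rescaled by the proximal operator,
    prox_alpha(x) = (1 - alpha mu) x, for every alpha > 0 with alpha mu < 1
    ([eigenvector_prox]).  This needs no continuity of alpha: both parameter
    rules give 0 < alpha(x) mu <= c at the point x itself. *)

(** * Real inner products *)

Section InnerProduct.
Context (R : realType) (H : completeNormedModType R).
Context (ip : {dot H for (@idfun R)}) (hip : induces_norm ip).

Lemma ipC x y : ip x y = ip y x.
Proof. by rewrite hermC expr0 mul1r. Qed.

Lemma ipDl x y z : ip (x + y) z = ip x z + ip y z.
Proof. exact: linearDl. Qed.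

Lemma ipDr x y z : ip x (y + z) = ip x y + ip x z.
Proof. exact: linearDr. Qed.

Lemma ipZl (a : R) x y : ip (a *: x) y = a * ip x y.
Proof. exact: linearZl_LR. Qed.

Lemma ipZr (a : R) x y : ip x (a *: y) = a * ip x y.
Proof. exact: linearZr. Qed.

Lemma ipBl x y z : ip (x - y) z = ip x z - ip y z.
Proof. exact: linearBl. Qed.

Lemma ipBr x y z : ip x (y - z) = ip x y - ip x z.
Proof. exact: linearBr. Qed.

Lemma ip0r x : ip x 0 = 0.
Proof. exact: linear0r. Qed.

Lemma norm2D x y : `|x + y| ^+ 2 = `|x| ^+ 2 + 2 * ip x y + `|y| ^+ 2.
Proof. by rewrite !hip ipDl !ipDr (ipC y x); ring. Qed.

Lemma norm2B x y : `|x - y| ^+ 2 = `|x| ^+ 2 - 2 * ip x y + `|y| ^+ 2.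
Proof. by rewrite !hip ipBl !ipBr (ipC y x); ring. Qed.

(** Cauchy-Schwarz, from expanding the squared norm of |y| x - |x| y. *)
Lemma ip_le_norm x y : ip x y <= `|x| * `|y|.
Proof.
have [->|x0] := eqVneq x 0; first by rewrite ipC ip0r normr0 mul0r.
have [->|y0] := eqVneq y 0; first by rewrite ip0r normr0 mulr0.
have xy0 : 0 < `|x| * `|y| by rewrite mulr_gt0 ?normr_gt0.
have := sqr_ge0 `| `|y| *: x - `|x| *: y|.
rewrite norm2B !normrZ !normr_id ipZl ipZr; nra.
Qed.

(** Polarization reduces continuity of the inner product to continuity of the
    norm. *)
Lemma cvg_ip {T : Type} (F : set_system T) {FF : Filter F} (x y : T -> H)
    (a b : H) :
  x @ F --> a -> y @ F --> b -> ip (x t) (y t) @[t --> F] --> ip a b.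
Proof.
have polar s t : ip s t = 2^-1 * (`|s + t| * `|s + t| - `|s| * `|s| - `|t| * `|t|).
  by rewrite -!expr2 norm2D; field.
move=> xa yb; rewrite polar; under eq_fun do rewrite polar.
apply: cvgM; first exact: cvg_cst.
by apply: cvgB; [apply: cvgB|]; apply: cvgM; apply: cvg_norm => //; apply: cvgD.
Qed.

End InnerProduct.

(** * Lower semi-continuous functions *)

Section Lsc.
Context (R : realType).

Lemma lsc_le_lim (X : topologicalType) (J : X -> \bar R) (T : Type)
    (F : set_system T) {FF : ProperFilter F} (x : T -> X) (l : X)
    (b : T -> R) (m : R) :
  lower_semicontinuous J -> x @ F --> l -> b @ F --> m ->
  (forall t, (J (x t) <= (b t)%:E)%E) -> (J l <= m%:E)%E.
Proof.
move=> Jlsc xl bm Jb; rewrite leNgt; apply/negP => mJ.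
have [a ma aJ] : exists2 a : R, m < a & (a%:E < J l)%E.
  case: (J l) mJ => [r||] //=; last by exists (m + 1); rewrite ?ltry// ltrDl.
  by rewrite lte_fin => mr; exists ((m + r) / 2); rewrite ?lte_fin; lra.
have [V nV Va] := Jlsc _ _ aJ.
have ba : \forall t \near F, b t < a by apply: (cvgr_lt m).
have xV : \forall t \near F, V (x t) by exact: xl.
have [t [/Va + bt]] := @filter_ex _ F _ _ (filterI xV ba).
move=> /lt_le_trans/(_ (Jb t)); rewrite lte_fin => /lt_trans/(_ bt).
by rewrite ltxx.
Qed.

(** The sets {x in K | F x <= F y}, for y in K, form a chain of nonempty closed
    subsets of K; a cluster point of the filter they generate belongs to all of
    them. *)
Lemma lsc_compact_min (X : topologicalType) (F : X -> \bar R) (K : set X) :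
  lower_semicontinuous F -> compact K -> K !=set0 ->
  exists2 x, K x & forall y, K y -> (F x <= F y)%E.
Proof.
move=> Flsc Kc [x0 Kx0].
pose B y := [set x | K x /\ (F x <= F y)%E].
have BF : ProperFilter (filter_from K B).
  apply: filter_from_proper; last by move=> y Ky; exists y; split.
  apply: filter_from_filter; first by exists x0.
  move=> i j Ki Kj; have [ij|/ltW ji] := leP (F i) (F j).
    by exists i => // x [Kx xi]; split; split => //; exact: le_trans ij.
  by exists j => // x [Kx xi]; split; split => //; exact: le_trans ji.
have [x [Kx xB]] := Kc _ BF (ex_intro2 _ _ x0 Kx0 (fun x => @proj1 _ _)).
exists x => // y Ky; rewrite leNgt; apply/negP => yx.
have [a ya ax] : exists2 a : R, (F y <= a%:E)%E & (a%:E < F x)%E.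
  case: (F y) yx => [s yx||]; [by exists s|by rewrite ltNge leey|].
  case: (F x) => [s _|_|]; last by rewrite ltxx.
    by exists (s - 1); rewrite ?leNye// lte_fin ltrBlDr ltrDl.
  by exists 0; rewrite ?leNye ?ltry.
have [V nV Va] := Flsc _ _ ax.
have [z [[_ zy] /Va az]] := xB (B y) V (ex_intro2 _ _ y Ky (fun _ => id)) nV.
by have := lt_le_trans az (le_trans zy ya); rewrite ltxx.
Qed.

End Lsc.

(** * Extraction of subsequences *)

Section Sequences.
Context (R : realType).

Lemma increasing_selection (P : nat -> nat -> Prop) :
  (forall j N, exists2 k, (N <= k)%N & P j k) ->
  exists2 phi : nat -> nat,
    {homo phi : m n / (m < n)%N} & forall j, P j (phi j).
Proof.
move=> exP.
pose g j N := xget 0%N [set k | (N <= k)%N /\ P j k].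
have gP j N : (N <= g j N)%N /\ P j (g j N).
  have [k Nk Pk] := exP j N.
  by apply: (@xgetPex _ 0%N [set k | (N <= k)%N /\ P j k]); exists k.
pose fix phi j := if j is i.+1 then g j (phi i).+1 else g 0%N 0%N.
exists phi; last by case=> [|j]; exact: (gP _ _).2.
by apply: homo_ltn => [|j]; [exact: ltn_trans|exact: (gP _ _).1].
Qed.

(** The clustering is along the indices where r is small, not along all of them:
    the filter below is generated by the sets of k >= N with r k < e, so that
    one extraction makes x converge and bounds r simultaneously. *)
Lemma compact_subsequence (X : completeNormedModType R) (K : set X) (x : nat -> X)
    (r : nat -> R) :
  compact K -> (forall k, K (x k)) ->
  (forall (e : R) N, 0 < e -> exists2 k, (N <= k)%N & r k < e) ->
  exists (phi : nat -> nat) (l : X),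
    [/\ {homo phi : m n / (m < n)%N}, x (phi k) @[k --> \oo] --> l
      & forall k, r (phi k) < k.+1%:R^-1].
Proof.
move=> Kc Kx rs.
pose B (Ne : nat * R) := [set k | (Ne.1 <= k)%N /\ r k < Ne.2].
pose D := [set Ne : nat * R | 0 < Ne.2].
have BF : ProperFilter (filter_from D B).
  apply: filter_from_proper.
    apply: filter_from_filter; first by exists (0%N, 1); rewrite /D /=.
    move=> [N e] [M d] /= e0 d0; exists (maxn N M, Num.min e d).
      by rewrite /D /= lt_min; apply/andP.
    move=> k []/=; rewrite geq_max lt_min => /andP[? ?] /andP[? ?].
    by split; split.
  by move=> [N e] /= e0; have [k Nk rk] := rs e N e0; exists k.
have [l [Kl lc]] : K `&` cluster (x @ filter_from D B) !=set0.
  by apply: Kc; exists (0%N, 1) => [|k _]; [exact: ltr01|exact: Kx].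
pose P j k := `|l - x k| < j.+1%:R^-1 /\ r k < j.+1%:R^-1.
have [j N|phi phi_lt phiP] := @increasing_selection P.
  have j0 : 0 < j.+1%:R^-1 :> R by rewrite invr_gt0.
  have [_ [[k [Nk rk] <-] lk]] := lc (x @` B (N, j.+1%:R^-1)) (ball l j.+1%:R^-1)
    (ex_intro2 _ _ (N, j.+1%:R^-1) j0 (fun k Bk => ex_intro2 _ _ k Bk erefl))
    (nbhsx_ballx l _ j0).
  by exists k => //; split => //; move: lk; rewrite -ball_normE.
exists phi, l; split=> // [|k]; last exact: (phiP k).2.
apply/cvgrPdist_lt => e e0; near=> k.
apply: lt_trans (phiP k).1 _; near: k; exact: near_infty_natSinv_lt (PosNum e0).
Unshelve. all: by end_near. Qed.

(** Otherwise e <= r k from some index N on, and summing e a_k <= d_k - d_{k+1}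
    bounds the tail of the series of a by d_N / e. *)
Lemma liminf_weight (a r d : nat -> R) :
  (forall k, 0 <= a k) -> (forall k, 0 <= d k) ->
  (forall k, a k * r k <= d k - d k.+1) ->
  (\sum_(0 <= k <oo) (a k)%:E = +oo)%E ->
  forall (e : R) N, 0 < e -> exists2 k, (N <= k)%N & r k < e.
Proof.
move=> a0 d0 ard suma e N e0; apply: contrapT => rN.
have re k : (N <= k)%N -> e <= r k.
  by move=> Nk; rewrite leNgt; apply/negP => rk; apply: rN; exists k.
have tail n : \sum_(N <= k < N + n) a k <= (d N - d (N + n)%N) / e.
  elim: n => [|n IH]; first by rewrite addn0 big_geq// subrr mul0r.
  rewrite addnS big_nat_recr/= ?leq_addr//.
  have h : a (N + n)%N <= (d (N + n)%N - d (N + n).+1) / e.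
    rewrite ler_pdivlMr//; apply: le_trans (ard _).
    by rewrite ler_wpM2l// re ?leq_addr.
  apply: le_trans (lerD IH h) _.
  by rewrite -mulrDl ler_wpM2r ?invr_ge0 ?(ltW e0)//; lra.
pose M := \sum_(0 <= k < N) a k + d N / e.
suff: (\sum_(0 <= k <oo) (a k)%:E <= M%:E)%E by rewrite suma leye_eq.
apply: lime_le; first by apply: is_cvg_nneseries => k _ _; rewrite lee_fin.
near=> n; have Nn : (N <= n)%N by near: n; exists N.
rewrite sumEFin lee_fin (@big_cat_nat _ _ _ N)//= lerD2l.
rewrite -(subnKC Nn); apply: le_trans (tail _) _.
by rewrite ler_wpM2r ?invr_ge0 ?(ltW e0)// gerBl.
Unshelve. all: by end_near. Qed.

End Sequences.

(** * Subgradients and proximal maps of one-homogeneous functionals *)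

Section Functional.
Context (R : realType) (H : completeNormedModType R).
Context (ip : {dot H for (@idfun R)}) (hip : induces_norm ip).
Context (J : H -> \bar R).
Context (J_proper : proper_codomain J) (J_convex : econvex J).
Context (J_lsc : lower_semicontinuous J) (J_hom : abs_one_homogeneous J).

(** For absolutely one-homogeneous convex J this is membership of p in the
    subdifferential of J at x: testing the subgradient inequality at multiples
    of x splits it into these two conditions. *)
Definition subgradient (p x : H) : Prop :=
  (forall w, ((ip p w)%:E <= J w)%E) /\ (ip p x)%:E = J x.

Lemma homogeneousZ (a r : R) x : 0 <= a -> J x = r%:E -> J (a *: x) = (a * r)%:E.
Proof.
rewrite le_eqVlt => /predU1P[<- _|a0 Jx].
  by rewrite scale0r mul0r J_hom.2.
by rewrite J_hom.1 ?gt_eqF// Jx ger0_norm ?ltW.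
Qed.

Lemma homogeneousN x : J (- x) = J x.
Proof. by rewrite -scaleN1r J_hom.1 ?oppr_eq0 ?oner_eq0// normrN1 mul1e. Qed.

(** Zero is the midpoint of x and - x. *)
Lemma homogeneous_ge0 x : (0 <= J x)%E.
Proof.
have half01 : 0 <= (2^-1 : R) <= 1.
  by rewrite invr_ge0 ler0n invf_le1 ?ler1n ?ltr0n.
have := J_convex x (- x) half01; have -> : 1 - 2^-1 = 2^-1 :> R by field.
rewrite scalerN subrr J_hom.2 homogeneousN.
case: (J x) (J_proper x) => [r _||//]; last by rewrite leey.
by rewrite -!EFinM -EFinD !lee_fin; lra.
Qed.

(** Since J vanishes at both w and - w for w in the null-space. *)
Lemma subgradient_ortho p x : subgradient p x -> orthocompl ip (nullspace J) p.
Proof.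
move=> [pJ _] w Jw; apply/eqP; rewrite eq_le.
have := pJ (- w); have := pJ w.
rewrite homogeneousN Jw !lee_fin -scaleN1r ipZr mulN1r.
by rewrite oppr_le0 => -> ->.
Qed.

Lemma orthocomplZ (A : set H) (a : R) x :
  orthocompl ip A x -> orthocompl ip A (a *: x).
Proof. by move=> xA w Aw; rewrite ipZl xA// mulr0. Qed.

Lemma orthocomplB (A : set H) x y :
  orthocompl ip A x -> orthocompl ip A y -> orthocompl ip A (x - y).
Proof. by move=> xA yA w Aw; rewrite ipBl xA// yA// subrr. Qed.

(** The graph of the subdifferential is closed, and J is continuous along it:
    lower semi-continuity gives J x <= m, and m = lim <p_t, x_t> = <p, x> <= J x
    gives the converse. *)
Lemma subgradient_closed (T : Type) (F : set_system T) {FF : ProperFilter F}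
    (p x : T -> H) (j : T -> R) (q y : H) (m : R) :
  (forall t, subgradient (p t) (x t)) -> (forall t, J (x t) = (j t)%:E) ->
  p @ F --> q -> x @ F --> y -> j @ F --> m ->
  subgradient q y /\ J y = m%:E.
Proof.
move=> px xj pq xy jm.
have qw w : ((ip q w)%:E <= J w)%E.
  have := homogeneous_ge0 w; case Jw: (J w) => [r||]// _; last exact: leey.
  have pw : ip (p t) w @[t --> F] --> ip q w.
    by apply: (cvg_ip hip pq); exact: cvg_cst.
  rewrite lee_fin -(cvg_lim (@Rhausdorff R) pw); apply: limr_le.
    by apply/cvg_ex; eexists; exact: pw.
  by apply: nearW => t; have := (px t).1 w; rewrite Jw lee_fin.
have qy : ip q y = m.
  have pxE : (fun t => ip (p t) (x t)) = j.
    by apply/funext => t; have := (px t).2; rewrite xj => -[].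
  have : ip (p t) (x t) @[t --> F] --> ip q y by exact: (cvg_ip hip).
  by rewrite pxE => /(cvg_lim (@Rhausdorff R)) <-; exact: cvg_lim jm.
have Jy : J y = m%:E.
  apply/eqP; rewrite eq_le -{2}qy qw andbT.
  by apply: (lsc_le_lim J_lsc xy jm) => t; rewrite xj.
by split => //; split => //; rewrite qy.
Qed.

Lemma prox_objective_lsc (a : R) x : 0 < a ->
  lower_semicontinuous (prox_objective J a x).
Proof.
move=> a0 y b; rewrite /prox_objective => by_.
pose q z : R := 2^-1 * `|z - x| ^+ 2.
have qc : q z @[z --> y] --> q y.
  apply: cvgM; first exact: cvg_cst.
  rewrite expr2; under eq_fun do rewrite expr2.
  by apply: cvgM; apply: cvg_norm; apply: cvgB; exact: cvg_id || exact: cvg_cst.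
(* a level below J y, even when J y is infinite, that still leaves the
   quadratic term room to vary *)
have [s bs sJ] : exists2 s : R, b < q y + a * s & (s%:E < J y)%E.
  move: by_; case: (J y) (J_proper y) => [r _||//].
    rewrite -EFinM -EFinD lte_fin -/(q y) => br.
    exists (r - (q y + a * r - b) / (2 * a)); last first.
      by rewrite lte_fin gtrBl divr_gt0; lra.
    rewrite mulrBr [a * (_ / _)](_ : _ = (q y + a * r - b) / 2); last first.
      by field; rewrite gt_eqF.
    lra.
  move=> _ _; exists ((b - q y + 1) / a); last exact: ltry.
  rewrite mulrCA divff ?gt_eqF// mulr1; lra.
have [V nV Vs] := J_lsc sJ.
exists (V `&` [set z | b - a * s < q z]).
  apply: filterI => //; apply: (cvgr_gt (q y)) => //; lra.
move=> z [/Vs sz] /= bz; rewrite -/(q z).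
apply: (@lt_trans _ _ (q z + a * s)%:E); first by rewrite lte_fin; lra.
by rewrite EFinD lteD2lE// EFinM lte_pmul2l.
Qed.

(** A point whose objective does not exceed the value a J x taken at x itself
    lies in one fixed compact sub-level set, so the minimum over that set is
    global. *)
Lemma prox_exists (a : R) x : 0 < a -> (J x < +oo)%E ->
  (forall b : R, compact [set u : H | (`|u|%:E + J u <= b%:E)%E]) ->
  argmin (prox_objective J a x) (prox J a x).
Proof.
move=> a0 Jx Kc.
have [j Jxj] : exists j, J x = j%:E.
  by exists (fine (J x)); rewrite fineK// ge0_fin_numE ?homogeneous_ge0.
(* if y does as well as x then J y <= j and |y - x|^2 <= 2 a j, and
   s <= 1 + s^2 bounds the distance without a square root *)
pose M := `|x| + 1 + 2 * a * j + j.
have j0 : 0 <= j by rewrite -lee_fin -Jxj homogeneous_ge0.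
have aj0 : 0 <= a * j by rewrite mulr_ge0// ltW.
have [] := lsc_compact_min (prox_objective_lsc (x := x) a0) (Kc M).
  by exists x; rewrite /= Jxj -EFinD lee_fin /M; lra.
move=> y Ky ymin; rewrite /prox; apply: xgetPex; exists y => w.
have [|nKw] := pselect ((`|w|%:E + J w <= M%:E)%E); first exact: ymin.
have Kx : (`|x|%:E + J x <= M%:E)%E by rewrite Jxj -EFinD lee_fin /M; lra.
apply: le_trans (ymin _ Kx) _; rewrite leNgt; apply/negP => wx; apply: nKw.
move: wx (homogeneous_ge0 w); rewrite /prox_objective Jxj.
rewrite subrr normr0 expr0n/= mulr0 add0e -EFinM.
case: (J w) => [r||//]; last by rewrite gt0_muley ?lte_fin// addey// ltNge leey.
rewrite -EFinM -!EFinD lte_fin !lee_fin => wx r0.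
have rj : r <= j.
  rewrite -(ler_pM2l a0); apply/ltW; apply: le_lt_trans wx.
  by rewrite lerDr mulr_ge0 ?invr_ge0 ?sqr_ge0.
have d2 : `|w - x| ^+ 2 <= 2 * a * j.
  have : 0 <= a * r by rewrite mulr_ge0// ltW.
  lra.
have d1 : `|w - x| <= 1 + 2 * a * j by nra.
have := ler_normD (w - x) x; rewrite subrK /M; lra.
Qed.

(** The first-order optimality condition.  Comparing y with t w + (1 - t) y and
    letting t tend to 0 gives <x - y, w - y> <= a (J w - J y) for all w; the
    choices w = 0 and w = 2 y then give <x - y, y> = a J y. *)
Lemma argmin_subgradient (a : R) x y : 0 < a -> (J x < +oo)%E ->
  argmin (prox_objective J a x) y -> subgradient (a^-1 *: (x - y)) y.
Proof.
move=> a0 Jx ymin.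
have [s Jys] : exists s, J y = s%:E.
  have := ymin x; rewrite /prox_objective.
  case: (J x) Jx (homogeneous_ge0 x) (homogeneous_ge0 y) => [j _ _||]//.
  case: (J y) => [s||]// _; first by exists s.
  by rewrite gt0_muley ?lte_fin// addey// leye_eq.
have var w r : J w = r%:E -> ip (x - y) (w - y) <= a * (r - s).
  move=> Jwr; rewrite leNgt -subr_gt0; apply/negP.
  set A := _ - _ => A0; pose B := 2^-1 * `|w - y| ^+ 2.
  have B0 : 0 <= B by rewrite mulr_ge0 ?invr_ge0 ?sqr_ge0.
  (* a step so small that the second-order cost t^2 B cannot offset the
     first-order gain t A *)
  pose t := A / (A + B).
  have AB0 : 0 < A + B by rewrite ltr_pwDl.
  have t0 : 0 < t by rewrite divr_gt0.
  have t1 : t <= 1 by rewrite ler_pdivrMr// mul1r lerDl.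
  have tB : t * B < A by rewrite mulrAC ltr_pdivrMr// mulrDr ltrDr mulr_gt0.
  suff : t * A <= t * (t * B) by rewrite ler_pM2l// leNgt tB.
  have := ymin (t *: w + (1 - t) *: y).
  have := @J_convex w y t; rewrite Jwr Jys (ltW t0) t1 => /(_ isT).
  have := homogeneous_ge0 (t *: w + (1 - t) *: y).
  rewrite /prox_objective Jys -!EFinM -!EFinD.
  have -> : t *: w + (1 - t) *: y - x = (y - x) + t *: (w - y).
    by rewrite scalerBl scale1r scalerBr addrCA addrAC.
  rewrite (norm2D hip (y - x)) normrZ exprMn (gtr0_norm t0) ipZr.
  have -> : ip (y - x) (w - y) = - ip (x - y) (w - y).
    by rewrite -mulN1r -ipZl scaleN1r opprB.
  case: (J _) => [z||]//= _; rewrite -?EFinM -?EFinD !lee_fin => zt.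
  rewrite /A /B; nra.
have Jy0 := var 0 0 J_hom.2.
have Jy2 := var (2 *: y) (2 * s) (homogeneousZ (ler0n _ _) Jys).
have xyy : ip (x - y) y = a * s.
  move: Jy0 Jy2; rewrite ![ip _ (_ - y)]ipBr ip0r ipZr.
  move=> ? ?; apply/eqP; rewrite eq_le; apply/andP; split; lra.
split; last by rewrite ipZl xyy Jys mulKf// gt_eqF.
move=> w; have := homogeneous_ge0 w.
case Jw : (J w) => [r||] // _; last exact: leey.
rewrite lee_fin ipZl ler_pdivrMl//.
by have := var w r Jw; rewrite ipBr xyy; lra.
Qed.

(** The subgradient inequality bounds J y below by mu <x, y>; completing the
    square then shows that the objective exceeds its value at (1 - a mu) x by at
    least half the squared distance to that point, which also gives uniqueness
    of the minimizer. *)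
Lemma eigenvector_prox (a mu : R) x : 0 < a -> a * mu < 1 ->
  subgradient (mu *: x) x -> (1 - a * mu) *: x = prox J a x.
Proof.
move=> a0 amu [muJ muE].
have Jx : J x = (mu * `|x| ^+ 2)%:E by rewrite -muE ipZl hip.
pose l := 1 - a * mu.
have l0 : 0 <= l by rewrite subr_ge0 ltW.
have Fl := homogeneousZ l0 Jx.
have key y r : J y = r%:E ->
  2^-1 * `|l *: x - x| ^+ 2 + a * (l * (mu * `|x| ^+ 2)) + 2^-1 * `|y - l *: x| ^+ 2
    <= 2^-1 * `|y - x| ^+ 2 + a * r.
  move=> Jy; have := muJ y; rewrite Jy lee_fin ipZl => mur.
  have : a * (mu * ip x y) <= a * r by rewrite ler_pM2l.
  rewrite !(norm2B hip) normrZ exprMn (ger0_norm l0) !ipZl !ipZr (ipC ip y x) -hip.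
  rewrite /l; lra.
symmetry; apply: xget_unique => [w|y ymin]; rewrite -/l.
  rewrite /prox_objective Fl -EFinM -EFinD.
  have := homogeneous_ge0 w; case Jw : (J w) => [r||]// _.
    rewrite -EFinM -EFinD lee_fin; apply: le_trans (key _ _ Jw).
    by rewrite lerDl mulr_ge0 ?invr_ge0 ?sqr_ge0.
  by rewrite gt0_muley ?lte_fin// addey// leey.
have := ymin (l *: x); rewrite /prox_objective Fl -EFinM -EFinD.
have := homogeneous_ge0 y; case Jy : (J y) => [r||]// _; last first.
  by rewrite gt0_muley ?lte_fin// addey// leye_eq.
rewrite -EFinM -EFinD lee_fin => /(le_trans (key _ _ Jy)).
rewrite gerDl pmulr_rle0 ?invr_gt0// => yl.
apply/eqP; rewrite -subr_eq0 -normr_eq0 -sqrf_eq0 eq_le yl.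
exact: sqr_ge0.
Qed.

(** One step of the method turns decrease of J into a bound on the residual.
    Indeed a^2 |p - j' x'|^2 = 1 - (|y| + a j')^2 because <p, x'> = j', while
    |y| >= <x, y> >= 1 - a j because <p, x> <= j. *)
Lemma power_step (a j : R) x y : 0 < a -> `|x| = 1 -> J x = j%:E -> a * j < 1 ->
  let p := a^-1 *: (x - y) in subgradient p y ->
  let x' := `|y|^-1 *: y in
  exists j' : R, [/\ `|x'| = 1, J x' = j'%:E, subgradient p x'
    & a * `|p - j' *: x'| ^+ 2 <= 2 * (j - j')].
Proof.
move=> a0 x1 Jx aj p [pJ py] x'.
have ap : a *: p = x - y by rewrite scalerA divff ?gt_eqF// scale1r.
have xy : 1 - a * j <= ip x y.
  have := pJ x; rewrite Jx lee_fin => pj.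
  have : a * ip p x <= a * j by rewrite ler_pM2l.
  rewrite -ipZl ap ipBl -hip x1 (ipC ip y); lra.
have ny : 1 - a * j <= `|y|.
  by apply: le_trans xy _; have := ip_le_norm hip x y; rewrite x1 mul1r.
have y0 : 0 < `|y| by apply: lt_le_trans ny; rewrite subr_gt0.
have x'1 : `|x'| = 1 by rewrite normrZ normfV normr_id mulVf// gt_eqF.
pose j' := ip p x'.
have Jx' : J x' = j'%:E.
  rewrite /j' ipZr; by apply: homogeneousZ; rewrite ?invr_ge0.
have pyE : ip p y = `|y| * j' by rewrite /j' ipZr mulVKf// gt_eqF.
have xyE : ip x y = `|y| ^+ 2 + a * (`|y| * j').
  by rewrite -pyE -ipZl ap ipBl -hip addrC subrK.
exists j'; split => //.
rewrite -(ler_pM2l a0).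
have -> : a * (a * `|p - j' *: x'| ^+ 2) = 1 - (`|y| + a * j') ^+ 2.
  rewrite (norm2B hip) ipZr -/j' [`|j' *: x'|]normrZ x'1 mulr1 real_normK ?num_real//.
  have := norm2B hip x y.
  rewrite -ap [`|a *: p|]normrZ exprMn (gtr0_norm a0) x1 xyE; lra.
(* 1 - s^2 <= 2 (1 - s) for s = |y| + a j' *)
have := sqr_ge0 (`|y| + a * j' - 1); lra.
Qed.

End Functional.

(** * Parameter rules *)

Section Rule.
Context (R : realType).

Lemma constant_series_pinfty (b : R) : 0 < b -> (\sum_(0 <= k <oo) b%:E = +oo)%E.
Proof.
move=> b0; apply/eqyP => A A0.
pose n := (Num.truncn (A / b)).+1.
apply: le_trans (@nneseries_lim_ge R (fun=> b%:E) xpredT 0 n _); last first.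
  by move=> k _ _; rewrite lee_fin ltW.
rewrite sumEFin lee_fin sumr_const_nat subn0 -mulr_natr mulrC -ler_pdivrMr//.
exact/ltW/truncnS_gt.
Qed.

Lemma divEFin (a r : R) : 0 < r -> (a%:E / r%:E = (a / r)%:E)%E.
Proof. by move=> r0; rewrite inver gt_eqF// -EFinM. Qed.

(** All that the argument uses of either rule: the constant rule satisfies the
    bound alpha(w) J(w) <= c only below the initial level J(u^0), which suffices
    because J decreases along the iteration and is lower semi-continuous. *)
Lemma rule_bounds (H : Type) (J : H -> \bar R) (c : R) (alpha : H -> R)
    (u : nat -> H) :
  0 < c -> (0 < J (u 0%N) < +oo)%E ->
  constant_rule J c (u 0%N) alpha \/
    (variable_rule J c alpha /\ nonvanishing J alpha u) ->
  (forall w, (0 < J w <= J (u 0%N))%E ->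
     0 < alpha w /\ ((alpha w)%:E * J w <= c%:E)%E)
  /\ (\sum_(0 <= k <oo) (alpha (u k))%:E = +oo)%E.
Proof.
move=> c0 /andP[Ju0 Ju0y].
case=> [ca|[va [a0 asum]]]; last first.
  split=> // w /andP[w0 wu0].
  have wy : (0 < J w < +oo)%E by rewrite w0 (le_lt_trans wu0).
  split; first exact: a0.
  have := va w wy; case: (J w) w0 wy => [r||]//; last by rewrite ltxx andbF.
  rewrite lte_fin => r0 _; rewrite divEFin// -EFinM !lee_fin.
  by rewrite ler_pdivlMr.
rewrite /constant_rule in ca.
case: (J (u 0%N)) ca Ju0 Ju0y => [j||]// ca; rewrite lte_fin => j0 _.
have aE w : alpha w = c / j.
  by have := ca w; rewrite divEFin// => -[].
split; last first.
  rewrite (eq_eseriesr (g := fun=> (c / j)%:E)) => [|k _]; last by rewrite aE.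
  by apply: constant_series_pinfty; rewrite divr_gt0.
move=> w /andP[w0 wj]; rewrite aE; split; first by rewrite divr_gt0.
case: (J w) w0 wj => [r||]//; rewrite lte_fin !lee_fin => r0 rj.
by rewrite mulrAC ler_pdivrMr// ler_pM2l.
Qed.

End Rule.

(** * Convergence of the proximal power method *)

Theorem theorem4p7 (R : realType) (H : completeNormedModType R)
    (ip : {dot H for (@idfun R)}) (hip : induces_norm ip)
    (J : H -> \bar R)
    (J_proper : proper_codomain J)
    (J_convex : econvex J)
    (J_lsc : lower_semicontinuous J)
    (J_hom : abs_one_homogeneous J)
    (poincare : exists2 cP : R, 0 < cP &
      forall u : H, orthocompl ip (nullspace J) u -> ((cP * `|u|)%:E <= J u)%E)
    (sublevel_compact : forall a : R,
      compact [set u : H | (`|u|%:E + J u <= a%:E)%E])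
    (f : H) (f_orth : orthocompl ip (nullspace J) f) (f_neq0 : f != 0)
    (c : R) (c_01 : 0 < c < 1)
    (alpha : H -> R) (alpha_ge0 : forall w, 0 <= alpha w)
    (u v : nat -> H)
    (hJu0 : (0 < J (u 0%N) < +oo)%E)
    (power : proximal_power_method J alpha f u v)
    (rule : constant_rule J c (u 0%N) alpha \/
            (variable_rule J c alpha /\ nonvanishing J alpha u)) :
  exists (phi : nat -> nat) (ustar : H),
    [/\ {homo phi : m n / (m < n)%N},
        u (phi k) @[k --> \oo] --> ustar,
        ustar != 0
      & exists2 lambda : R, 0 < lambda < 1 &
          lambda *: ustar = prox J (alpha ustar) ustar].
Proof.
have /andP[c0 c1] := c_01; have [u0E vE uSE] := power.
have [step_bound step_sum] := rule_bounds c0 hJu0 rule.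
have [cP cP0 poincareP] := poincare.
have J_ge0 := homogeneous_ge0 J_proper J_convex J_hom.
pose p k := (alpha (u k))^-1 *: (u k - v k).
pose j k := fine (J (u k)).
pose good k := [/\ `|u k| = 1, orthocompl ip (nullspace J) (u k),
  J (u k) = (j k)%:E, cP <= j k & j k <= j 0%N].
have Ju0 : J (u 0%N) = (j 0%N)%:E.
  by rewrite fineK// ge0_fin_numE ?J_ge0// (andP hJu0).2.
have good0 : good 0%N.
  have u01 : `|u 0%N| = 1 by rewrite u0E normrZ normfV normr_id mulVf ?normr_eq0.
  have u0o : orthocompl ip (nullspace J) (u 0%N).
    by move=> w Jw; rewrite u0E ipZl f_orth// mulr0.
  by split=> //; have := poincareP _ u0o; rewrite u01 mulr1 Ju0 lee_fin.
have good_alpha w r : 0 < r -> r <= j 0%N -> J w = r%:E ->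
    0 < alpha w /\ alpha w * r <= c.
  move=> r0 rj Jw; have := step_bound w.
  by rewrite Jw Ju0 lte_fin lee_fin r0 rj -EFinM lee_fin; exact.
have step k : good k -> [/\ good k.+1, subgradient ip J (p k) (u k.+1)
    & alpha (u k) * `|p k - j k.+1 *: u k.+1| ^+ 2 <= 2 * j k - 2 * j k.+1].
  move=> [uk1 uko Juk jk_ge jk_le].
  have [a0 ajc] := good_alpha _ _ (lt_le_trans cP0 jk_ge) jk_le Juk.
  have vmin : argmin (prox_objective J (alpha (u k)) (u k)) (v k).
    by rewrite vE; apply: prox_exists => //; rewrite Juk ltry.
  have pv : subgradient ip J (p k) (v k).
    by apply: argmin_subgradient => //; rewrite Juk ltry.
  have [j' []] := power_step hip J_hom a0 uk1 Juk
    (le_lt_trans ajc c1) pv.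
  rewrite -/(p k) -uSE => u'1 Ju' pu' dec.
  have jE : j k.+1 = j' by rewrite /j Ju'.
  have u'o : orthocompl ip (nullspace J) (u k.+1).
    have -> : u k.+1 = `|v k|^-1 *: (u k - alpha (u k) *: p k).
      by rewrite uSE /p scalerA divff ?gt_eqF// scale1r subKr.
    apply/orthocomplZ/orthocomplB => //.
    exact/orthocomplZ/(subgradient_ortho J_hom pv).
  have j'j : j' <= j k.
    rewrite -subr_ge0 -(pmulr_rge0 _ (ltr0n R 2)); apply: le_trans dec.
    by rewrite mulr_ge0 ?sqr_ge0// ltW.
  split; rewrite ?jE -?mulrBr//.
  split; rewrite ?jE//; last exact: le_trans jk_le.
  by have := poincareP _ u'o; rewrite Ju' lee_fin u'1 mulr1.
have goodk k : good k by elim: k => // k /step[].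
have decay := liminf_weight (a := fun k => alpha (u k))
  (r := fun k => `|p k - j k.+1 *: u k.+1| ^+ 2) (d := fun k => 2 * j k).
have {}decay := decay (fun k => alpha_ge0 _) _ _ step_sum.
have [] := @compact_subsequence R H
   [set u : H | (`|u|%:E + J u <= (1 + j 0%N)%:E)%E] (fun k => u k.+1)
   (fun k => `|p k - j k.+1 *: u k.+1| ^+ 2) (sublevel_compact _).
- by move=> k /=; have [-> _ -> _ jk] := goodk k.+1; rewrite -EFinD lee_fin lerD2l.
- apply: decay => k; last by have [] := step k (goodk k).
  by have [_ _ _ jk _] := goodk k; rewrite mulr_ge0// (le_trans (ltW cP0)).
move=> phi [x [phi_lt ux rphi]].
have j_anti : nonincreasing_seq j.
  apply/nonincreasing_seqP => k.
  have [_ _ h] := step k (goodk k).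
  rewrite -subr_ge0 -(pmulr_rge0 _ (ltr0n R 2)) mulrBr; apply: le_trans h.
  by rewrite mulr_ge0 ?sqr_ge0.
have j_lb k : cP <= j k by have [] := goodk k.
have [jcvg mu_ge] : cvgn j /\ cP <= limn j.
  have jc : cvgn j by apply: nonincreasing_is_cvgn => //; exists cP => _ [k _ <-].
  by split => //; apply: limr_ge => //; apply: nearW.
set mu := limn j in mu_ge.
have phi_oo : phi k @[k --> \oo] --> \oo.
  have phi_ge k : (k <= phi k)%N.
    by elim: k => // k IH; apply: leq_ltn_trans IH (phi_lt _ _ (ltnSn k)).
  by move=> A [N _ NA]; exists N => // k /= Nk; apply: NA; apply: leq_trans (phi_ge k).
have jphi : j (phi k).+1 @[k --> \oo] --> mu.
  have := cvg_comp _ _ phi_oo (cvg_comp _ _ (cvg_addnr 1) jcvg).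
  by under [X in X @ _]eq_fun do rewrite /= addn1.
have x1 : `|x| = 1.
  have : `|u (phi k).+1| @[k --> \oo] --> `|x| by exact: cvg_norm.
  have -> : (fun k => `|u (phi k).+1|) = fun=> 1.
    by apply/funext => k; have [] := goodk (phi k).+1.
  by move/(cvg_lim (@Rhausdorff R)) <-; rewrite lim_cst.
have pphi : p (phi k) @[k --> \oo] --> mu *: x.
  have mux : j (phi k).+1 *: u (phi k).+1 @[k --> \oo] --> mu *: x by exact: cvgZ.
  rewrite -[mu *: x]add0r; under eq_fun => k do
    rewrite -[p _](subrK (j (phi k).+1 *: u (phi k).+1)).
  apply: cvgD => //; apply/cvgr0Pnorm_lt => e e0.
  near=> k; rewrite -ltr_sqr ?nnegrE ?normr_ge0 ?(ltW e0)//.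
  apply: lt_trans (rphi k) _; near: k.
  exact: near_infty_natSinv_lt (PosNum (exprn_gt0 2 e0)).
have [mu_sub Jmu] : subgradient ip J (mu *: x) x /\ J x = mu%:E.
  apply: (subgradient_closed hip J_proper J_convex J_lsc J_hom _ _ pphi ux jphi).
    by move=> i; have [_ []] := step _ (goodk (phi i)).
  by move=> i; have [_ _ ->] := goodk (phi i).+1.
have mu0 : 0 < mu by apply: lt_le_trans mu_ge.
have mu_le : mu <= j 0%N by apply: nonincreasing_cvgn_ge.
have [a0 amu] := good_alpha _ _ mu0 mu_le Jmu.
(* phi selects steps with a small residual; it is the outcome of each such step
   that is close to x *)
exists (fun k => (phi k).+1), x; split => //.
  by rewrite -normr_gt0 x1 ltr01.
exists (1 - alpha x * mu).
  by rewrite subr_gt0 (le_lt_trans amu)//= ltrBlDr ltrDl mulr_gt0.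
by apply: (eigenvector_prox hip) => //; exact: le_lt_trans amu c1.
Unshelve. all: by end_near. Qed.
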